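(* Let $(a_n)$ be a sequence of positive real numbers with $a_n\to0$. For each $n$ and each $\beta\ge0$ consider the Dirichlet problem on $[0,\infty)$ with delta potential located at $x=a_n$, $$-y''(x)-\beta\,\delta(x-a_n)\,y(x)=\lambda y(x),\qquad y(0)=0,\quad y(a_n)=1,\qquad \lambda=-k^2<0,\ k>0,$$ and let $\beta_{cr}=\beta_{cr}(a_n)$ be the critical value of the coupling constant for this problem. Then $\beta_{cr}(a_n)\to\infty$ as $a_n\to0$.
   Context: For $a>0$ and $\beta\ge0$, a number $\lambda<0$ is a negative eigenvalue of the problem $-y''-\beta\delta(x-a)y=\lambda y$ on $[0,\infty)$ with $y(0)=0$, $y(a)=1$, if there is a function $y\in L^2(0,\infty)$, continuous on $[0,\infty)$, with $y(0)=0$ and $y(a)=1$ (the latter is a normalization of the eigenfunction), satisfying $-y''=\lambda y$ on $(0,a)$ and on $(a,\infty)$, and satisfying the jump condition $-(y'(a^+)-y'(a^-))=\beta y(a)$, which expresses the delta potential at $x=a$. The critical value $\beta_{cr}(a)\ge 0$ of the coupling constant is the value such that the problem has no negative eigenvalues for $0\le\beta<\beta_{cr}(a)$ and has negative eigenvalues for every $\beta>\beta_{cr}(a)$. *)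

(* Defs.v *)
From HB Require Import structures.
From mathcomp Require Import all_boot all_order all_algebra.
From mathcomp Require Import all_classical all_reals all_analysis.

Set Implicit Arguments.
Unset Strict Implicit.
Unset Printing Implicit Defensive.

Import Order.TTheory GRing.Theory Num.Theory.
Import numFieldNormedType.Exports.

Local Open Scope classical_set_scope.
Local Open Scope ring_scope.

(* [y] is a normalized eigenfunction, for the eigenvalue [lam], of the Dirichlet
   problem on [0, +oo) with potential [- beta * delta (x - a)].
   Only the values of [y] on [0, +oo) matter: membership in L^2(0, +oo) is
   membership in L^2 of the extension by zero, and the two intervals (0, a) and
   (a, +oo) are open, so that the two-sided derivatives there do not depend on
   the values of [y] at negative points. *)
Definition delta_eigenfunction (R : realType) (a beta lam : R) (y : R -> R) :=
  [/\ y \_ `]0, +oo[ \in Lfun (@lebesgue_measure R) 2%:E,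
      {within `[0, +oo[, continuous y},
      y 0 = 0 /\ y a = 1,
      (forall x : R, 0 < x < a \/ a < x ->
        [/\ derivable y x 1, derivable y^`()%classic x 1 & - y^`(2)%classic x = lam * y x]) &
      exists dl dr : R,
        [/\ y^`()%classic x @[x --> a^'-] --> dl,
            y^`()%classic x @[x --> a^'+] --> dr &
            - (dr - dl) = beta * y a] ].

Definition delta_negative_eigenvalue (R : realType) (a beta lam : R) :=
  lam < 0 /\ exists y : R -> R, delta_eigenfunction a beta lam y.

Definition is_critical_coupling (R : realType) (a b : R) :=
  [/\ 0 <= b,
      (forall beta, 0 <= beta -> beta < b ->
        ~ exists lam, delta_negative_eigenvalue a beta lam) &
      forall beta, b < beta ->
        exists lam, delta_negative_eigenvalue a beta lam].

(* "The" critical value, as a definite description: two distinct numbers cannot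
   both satisfy [is_critical_coupling a]. If no number did, [beta_cr a] would
   be [0], so a statement that [beta_cr] is unbounded does not hold by default. *)
Definition beta_cr (R : realType) (a : R) : R := get (is_critical_coupling a).

(* Main.v *)
(** The critical coupling of the problem at distance [a] is exactly [a^-1], which
    tends to infinity with [a --> 0]. Writing [lam = - k ^+ 2], an eigenfunction
    is [sinh (k x) / sinh (k a)] on [(0, a)] and, being square integrable,
    [exp (- k (x - a))] on [(a, +oo)]; the jump condition becomes
    [beta = k (1 + coth (k a))], that is
    [2 k = beta (1 - exp (- 2 k a))]. Since [1 - exp (- t) <= t], a solution
    [k > 0] forces [a^-1 <= beta]; conversely, for [a^-1 < beta] a solution
    exists by the intermediate value theorem. *)
Require Import Defs.
From HB Require Import structures.
From mathcomp Require Import all_boot all_order all_algebra.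
From mathcomp Require Import ring lra.
From mathcomp Require Import all_classical all_reals all_analysis.
From mathcomp Require Import measurable_realfun.

Import Order.TTheory GRing.Theory Num.Theory.
Import numFieldNormedType.Exports.

Local Open Scope classical_set_scope.
Local Open Scope ring_scope.

(** * Solutions of [y'' = k ^+ 2 * y] on an interval *)

Lemma is_derive_0_cst_itv {R : realType} (i : interval R) (f : R -> R) x y :
  (forall z, z \in i -> is_derive z (1 : R) f 0) -> x \in i -> y \in i ->
  f x = f y.
Proof.
move=> df; wlog xy : x y / x <= y.
  by move=> H ix iy; by case: (leP x y) => [/H->|/ltW/H->].
move=> ix iy.
have sub z : z \in `[x, y] -> z \in i.
  rewrite in_itv/= => xzy.
  by have := @interval_is_interval _ i x y ix iy z xzy.
have dxy z : z \in `]x, y[ -> is_derive z (1 : R) f 0.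
  by move=> zxy; apply/df/sub/subset_itv_oo_cc.
have cxy : {within `[x, y], continuous f}.
  apply: continuous_in_subspaceT => z /[!inE] zxy.
  have [? _] := df z (sub z zxy).
  exact/differentiable_continuous/derivable1_diffP.
have [z _] := MVT_segment xy dxy cxy.
by rewrite mul0r => /subr0_eq.
Qed.

(** General solution of [y'' = k ^+ 2 * y]. The family is closed under differentiation, so [y'] is
    again recorded by two coefficients. *)
Definition expsol {R : realType} (k A B x : R) :=
  A * expR (k * x) + B * expR (- (k * x)).

Lemma is_derive_expsol {R : realType} (k A B x : R) :
  is_derive x 1 (expsol k A B) (expsol k (k * A) (- k * B) x).
Proof.
have d1 : is_derive x 1 (fun z : R => k * z) k.
  by apply: is_derive_eq; rewrite [LHS]mulr1.
have d2 : is_derive x 1 (fun z : R => expR (k * z)) (expR (k * x) * k).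
  exact: (@is_derive1_comp _ expR).
have d3 : is_derive x 1 (fun z : R => expR (- (k * z))) (expR (- (k * x)) * - k).
  exact: (@is_derive1_comp _ expR (fun z => - (k * z))).
apply: is_derive_eq.
by rewrite /expsol /GRing.scale/=; ring.
Qed.

Lemma continuous_expsol {R : realType} (k A B : R) : continuous (expsol k A B).
Proof.
move=> x; have [? _] := is_derive_expsol k A B x.
exact/differentiable_continuous/derivable1_diffP.
Qed.

(** The closed form of [y'] is kept alongside that of [y] because the jump condition needs the
    one-sided limits of [y']. *)
Lemma expsol_ode (R : realType) (i : interval R) (y : R -> R) (k : R) :
  k != 0 ->
  (forall x, x \in i -> [/\ derivable y x 1, derivable y^`()%classic x 1 &
      y^`(2)%classic x = k ^+ 2 * y x]) ->
  exists A B, forall x, x \in i ->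
    y x = expsol k A B x /\ y^`()%classic x = expsol k (k * A) (- k * B) x.
Proof.
move=> k0 yode.
have [[x0 ix0]|noi] := pselect (exists x, x \in i); last first.
  by exists 0, 0 => x ix; case: noi; exists x.
(* [(y' + c y) exp (- c x)] is a first integral for [c = k] and [c = - k]; the
   two together determine [y] and [y']. *)
have first_integral (c : R) : c ^+ 2 = k ^+ 2 -> forall x, x \in i ->
    (y^`()%classic x + c * y x) * expR (- (c * x)) =
    (y^`()%classic x0 + c * y x0) * expR (- (c * x0)).
  move=> ck x ix.
  apply: (@is_derive_0_cst_itv _ i
    (fun x => (y^`()%classic x + c * y x) * expR (- (c * x)))) => // z iz.
  have [dy dy' y2] := yode z iz.
  have d0 : is_derive z 1 y (y^`()%classic z).
    by apply: DeriveDef => //; rewrite derive1E.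
  have d1 : is_derive z 1 y^`()%classic (k ^+ 2 * y z).
    by apply: DeriveDef => //; rewrite -y2 derive1nS derive1E.
  have d2 : is_derive z 1 (fun z : R => expR (- (c * z))) (expR (- (c * z)) * - c).
    apply: (@is_derive1_comp _ expR (fun z => - (c * z))).
    by apply: is_derive_eq; rewrite [c *: _]mulr1.
  by apply: is_derive_eq; rewrite -ck /GRing.scale/=; ring.
(* [P] and [Q] are the constant values of the two first integrals: [y' + k y = P exp (k x)] and
   [y' - k y = Q exp (- k x)]. Subtracting gives [2 k y], adding gives [2 y']. *)
set P := (y^`()%classic x0 + k * y x0) * expR (- (k * x0)).
set Q := (y^`()%classic x0 + - k * y x0) * expR (- (- k * x0)).
exists (P / (2 * k)), (- Q / (2 * k)) => x ix.
have hP : y^`()%classic x + k * y x = P * expR (k * x).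
  by rewrite /P -(first_integral k erefl x ix) -mulrA -expRD addNr expR0 mulr1.
have hQ : y^`()%classic x - k * y x = Q * expR (- (k * x)).
  rewrite /Q -(first_integral (- k) (sqrrN k) x ix) -mulrA -expRD (mulNr k x).
  by rewrite addNr expR0 mulr1 mulNr.
have k2 : 2 * k != 0 by rewrite mulf_neq0// pnatr_eq0.
rewrite /expsol; split; apply: (mulfI k2).
  transitivity (P * expR (k * x) - Q * expR (- (k * x))); last by field.
  by rewrite -hP -hQ; ring.
transitivity (k * (P * expR (k * x) + Q * expR (- (k * x)))); last by field.
by rewrite -hP -hQ; ring.
Qed.

(** * Square integrability excludes the growing exponential *)

(** Otherwise the constant 1 would be integrable on a half-line, which has infinite measure. *)
Lemma Lfun2_eventually_ge1 {R : realType} (f : R -> R) (M : R) :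
  f \in Lfun (@lebesgue_measure R) 2%:E ->
  ~ (forall x, M < x -> 1 <= f x ^+ 2).
Proof.
move=> /Lfun2_integrable_sqr f2 f1.
have {}f2 : (@lebesgue_measure R).-integrable `]M, +oo[ (fun x => (f x ^+ 2)%:E).
  by apply: integrableS f2.
have : (@lebesgue_measure R).-integrable `]M, +oo[%classic (cst 1%:E).
  apply: le_integrable f2 => //.
  move=> x /=; rewrite in_itv/= andbT => /f1 ?.
  by rewrite lee_fin normr1 ger0_norm// sqr_ge0.
move=> /integrableP[_].
rewrite (eq_integral (cst 1%:E)); last by move=> x _ /=; rewrite normr1.
by rewrite integral_cst// mul1e [X in (X < _)%E]lebesgue_measure_itv/= ltry.
Qed.

Lemma Lfun2_expsol {R : realType} (y : R -> R) (k A B a : R) :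
  0 < k -> 0 < a -> y \_ `]0, +oo[ \in Lfun (@lebesgue_measure R) 2%:E ->
  (forall x, a < x -> y x = expsol k A B x) -> A = 0.
Proof.
move=> k0 a0 yL2 yE; apply/eqP/negPn/negP => A0.
have c0 : 0 < 2 * k * A ^+ 2 by rewrite mulr_gt0 ?exprn_even_gt0 ?mulr_gt0.
(* The square of the solution is at least [A^2 exp (2 k x) + 2 A B], hence at least
   [A^2 (1 + 2 k x) - 2 |A B|]. Past the second bound in the maximum, [2 k A^2 x] exceeds
   [1 + 2 |A B|]; past [a], the closed form of [y] is valid. *)
apply: (Lfun2_eventually_ge1 _
  (Num.max a ((1 + 2 * `|A * B|) / (2 * k * A ^+ 2))) yL2) => x.
rewrite gt_max ltr_pdivrMr// => /andP[ax cx].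
rewrite patchE ifT; last first.
  by rewrite inE/= in_itv/= andbT (lt_trans a0).
rewrite yE// /expsol.
have EE : expR (k * x) * expR (- (k * x)) = 1 by rewrite expRN mulfV// gt_eqF// expR_gt0.
have -> : (A * expR (k * x) + B * expR (- (k * x))) ^+ 2 =
    A ^+ 2 * expR (k * x) ^+ 2 + 2 * (A * B) * (expR (k * x) * expR (- (k * x)))
    + (B * expR (- (k * x))) ^+ 2 by ring.
rewrite EE mulr1 -expRM_natl.
have := sqr_ge0 (B * expR (- (k * x))).
have : A ^+ 2 * (1 + 2%:R * (k * x)) <= A ^+ 2 * expR (2%:R * (k * x)).
  by rewrite ler_wpM2l ?sqr_ge0 ?expR_ge1Dx.
have := ler_norm (- (A * B)); rewrite normrN.
have := sqr_ge0 A.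
lra.
Qed.

(** * A negative eigenvalue forces [a^-1 <= beta] *)

(** Carries a closed form from an open interval to its endpoint; [F] will be [0^'+], [a^'-] or
    [a^'+]. *)
Lemma cvg_near_eq_continuous {R : realType} (F : set_system R) (f g : R -> R) (p l : R) :
  ProperFilter F -> F --> p -> continuous g ->
  (\forall x \near F, f x = g x) -> f x @[x --> F] --> l -> l = g p.
Proof.
move=> FF Fp cg fg fl; apply: (@cvg_unique _ (@Rhausdorff R) (f @ F)) => //.
apply: (@cvg_trans _ (g @ F)); last exact: (continuous_cvg _ (cg p)).
by apply: near_eq_cvg; near do apply: esym.
Unshelve. all: by end_near. Qed.

Lemma delta_negative_eigenvalue_ge {R : realType} (a beta lam : R) :
  0 < a -> delta_negative_eigenvalue a beta lam -> a^-1 <= beta.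
Proof.
move=> a0 [lam0 [y [yL2 cy [y0 ya] ode [dl [dr [ydl ydr jump]]]]]].
set k := Num.sqrt (- lam).
have k0 : 0 < k by rewrite sqrtr_gt0 oppr_gt0.
have lamE : lam = - k ^+ 2 by rewrite sqr_sqrtr ?opprK// oppr_ge0 ltW.
have ode' x : 0 < x < a \/ a < x -> [/\ derivable y x 1,
    derivable y^`()%classic x 1 & y^`(2)%classic x = k ^+ 2 * y x].
  by move=> /ode[? ? /eqP]; rewrite lamE mulNr eqr_opp => /eqP ?; split.
have [A [B yl]] : exists A B, forall x, x \in `]0, a[ ->
    y x = expsol k A B x /\ y^`()%classic x = expsol k (k * A) (- k * B) x.
  by apply: expsol_ode; [exact: lt0r_neq0|move=> x /[!in_itv]/= ?; apply: ode'; left].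
have [A' [B' yr]] : exists A B, forall x, x \in `]a, +oo[ ->
    y x = expsol k A B x /\ y^`()%classic x = expsol k (k * A) (- k * B) x.
  apply: expsol_ode; [exact: lt0r_neq0|move=> x].
  by rewrite in_itv/= andbT => ?; apply: ode'; right.
have A'0 : A' = 0.
  by apply: (Lfun2_expsol y k A' B' a k0 a0 yL2) => x ax; apply: (yr x _).1; rewrite in_itv/= ax.
have [cya y0r] := (continuous_within_itvcyP _ _).1 cy.
have {}cya : y x @[x --> a] --> y a by apply: cya; rewrite in_itv/= a0.
have near0 : \forall x \near 0^'+, x \in `]0, a[.
  by near=> x; rewrite in_itv/=; apply/andP; split.
have nearl : \forall x \near a^'-, x \in `]0, a[.
  by near=> x; rewrite in_itv/=; apply/andP; split.
have nearr : \forall x \near a^'+, x \in `]a, +oo[.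
  by near=> x; rewrite in_itv/= andbT.
have e0 : y 0 = expsol k A B 0.
  apply: (cvg_near_eq_continuous 0^'+ y) y0r; [|exact: continuous_expsol|].
    exact: cvg_within.
  by near=> x; apply: (yl x _).1; near: x.
have el : y a = expsol k A B a.
  apply: (cvg_near_eq_continuous a^'- y) (cvg_at_left_filter cya);
    [|exact: continuous_expsol|].
    exact: cvg_within.
  by near=> x; apply: (yl x _).1; near: x.
have er : y a = expsol k A' B' a.
  apply: (cvg_near_eq_continuous a^'+ y) (cvg_at_right_filter cya);
    [|exact: continuous_expsol|].
    exact: cvg_within.
  by near=> x; apply: (yr x _).1; near: x.
have edl : dl = expsol k (k * A) (- k * B) a.
  apply: cvg_near_eq_continuous ydl; [|exact: continuous_expsol|].
    exact: cvg_within.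
  by near=> x; apply: (yl x _).2; near: x.
have edr : dr = expsol k (k * A') (- k * B') a.
  apply: cvg_near_eq_continuous ydr; [|exact: continuous_expsol|].
    exact: cvg_within.
  by near=> x; apply: (yr x _).2; near: x.
move: e0 el er edl edr; rewrite /expsol y0 ya A'0.
rewrite !(mulr0, oppr0, expR0, mulr1, mul0r, add0r).
set E := expR (k * a); set E' := expR (- (k * a)) => AB el er edl edr.
have BA : B = - A by lra.
(* Here [dl = k A (E + E')] and [dr = - k B' E' = - k]. Writing this last 1 as [A (E - E')], the
   value of [y a] from the left, gives [dl - dr = 2 k A E]. *)
have betaE : beta = 2 * k * (A * E).
  move: jump; rewrite ya mulr1 edl edr => <-; move: el er; rewrite BA => el er.
  have -> : k * A * E + - k * - A * E' = k * (A * E + A * E') by ring.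
  have -> : - k * B' * E' = - k * (B' * E') by ring.
  by rewrite -er [in X in - (X - _)](_ : 1 = A * E + - A * E') //; ring.
have E0 : 0 < E by exact: expR_gt0.
have EE' : E' = E * expR (- (2 * (k * a))).
  by rewrite /E /E' -expRD; congr expR; ring.
have le1 : 1 - 2 * (k * a) <= expR (- (2 * (k * a))) by exact: expR_ge1Dx.
(* This is [y a = 1] with [E] factored out. Since [1 - exp (- t) <= t] at [t = 2 k a], it yields
   [1 <= 2 k A E a = beta a]. *)
have AE : A * E * (1 - expR (- (2 * (k * a)))) = 1.
  by rewrite [RHS]el BA EE'; ring.
have AE0 : 0 < A * E.
  have : 0 < 1 - expR (- (2 * (k * a))).
    by rewrite subr_gt0 expR_lt1 oppr_lt0 !mulr_gt0.
  by move=> h; rewrite -(pmulr_lgt0 _ h) AE.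
rewrite -div1r ler_pdivrMr// betaE.
have : A * E * (1 - expR (- (2 * (k * a)))) <= A * E * (2 * (k * a)).
  by rewrite ler_pM2l//; lra.
by rewrite AE; lra.
Unshelve. all: by end_near. Qed.

(** * Construction of an eigenfunction when [a^-1 < beta] *)

(** Since [k = 0] is always a root, the intermediate value theorem is applied on a segment whose
    left end [k1] is positive. *)
Lemma exists_decay_rate {R : realType} (a beta : R) :
  0 < a -> a^-1 < beta ->
  exists2 k, 0 < k & 2 * k = beta * (1 - expR (- (2 * (k * a)))).
Proof.
move=> a0 ab.
have ab1 : 1 < a * beta by rewrite mulrC -ltr_pdivrMr// div1r.
have b0 : 0 < beta by rewrite (lt_trans _ ab)// invr_gt0.
pose g (k : R) := beta * (1 - expR (- (2 * (k * a)))) - 2 * k.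
(* [2 k1 a = a beta - 1] makes [expR (2 k1 a) >= a beta], hence [g k1 >= 0]. *)
pose k1 := (a * beta - 1) / (2 * a).
have k10 : 0 < k1 by rewrite divr_gt0 ?mulr_gt0// subr_gt0.
have k1a : 2 * (k1 * a) = a * beta - 1 by rewrite /k1; field; exact: lt0r_neq0.
have k12 : k1 <= beta / 2.
  by rewrite ler_pdivrMr ?mulr_gt0// (_ : _ / _ * _ = a * beta); [lra|field].
have cg : {within `[k1, beta / 2], continuous g}.
  apply: continuous_subspaceT => x.
  have gE z : g z = expsol (2 * a) 0 (- beta) z + (beta - 2 * z).
    rewrite /g /expsol mul0r add0r (_ : 2 * a * z = 2 * (z * a)); ring.
  rewrite (funext gE); apply: cvgD; first exact: continuous_expsol.
  by apply: cvgB; [exact: cvg_cst|apply: cvgM; [exact: cvg_cst|exact: cvg_id]].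
have gk1 : 0 <= g k1.
  have h : expR (- (a * beta - 1)) <= (a * beta)^-1.
    rewrite expRN lef_pV2 ?posrE ?expR_gt0 ?mulr_gt0//.
    by rewrite (le_trans _ (expR_ge1Dx _))// addrC subrK.
  have {}h : beta * expR (- (a * beta - 1)) <= a^-1.
    rewrite (le_trans (ler_wpM2l (ltW b0) h))// invfM mulrCA divff ?mulr1//.
    exact: lt0r_neq0.
  have k1E : 2 * k1 = beta - a^-1.
    by rewrite /k1; field; exact: lt0r_neq0.
  by rewrite /g k1a k1E; lra.
have gk2 : g (beta / 2) <= 0.
  rewrite /g (_ : 2 * (beta / 2) = beta); last by field.
  by rewrite mulrBr mulr1 addrAC subrr add0r oppr_le0 mulr_ge0 ?ltW// expR_gt0.
have [|k] := IVT k12 cg (v := 0).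
  by rewrite ge_min gk2 orbT le_max gk1.
rewrite in_itv/= => /andP[k1k _] gk; exists k; first exact: lt_le_trans k1k.
by apply/esym/subr0_eq.
Qed.

(** On an open set the equality holds near each point, so it passes to derivatives, first of [y] and
    then of [y']. *)
Lemma ode_expsol {R : realType} (U : set R) (y : R -> R) (k A B : R) :
  open U -> (forall x, U x -> y x = expsol k A B x) ->
  forall x, U x -> [/\ derivable y x 1, derivable y^`()%classic x 1,
    y^`()%classic x = expsol k (k * A) (- k * B) x &
    y^`(2)%classic x = k ^+ 2 * y x].
Proof.
move=> oU yE x Ux.
have dy z : U z -> is_derive z 1 y (expsol k (k * A) (- k * B) z).
  move=> Uz; apply: near_eq_is_derive (is_derive_expsol k A B z).
  by near=> t; apply/esym/yE; near: t; exact: open_nbhs_nbhs.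
have y'E z : U z -> y^`()%classic z = expsol k (k * A) (- k * B) z.
  by move=> /dy[_ <-]; rewrite derive1E.
have [dy1 _] := dy x Ux.
have [dy2 y2] : is_derive x 1 y^`()%classic
    (expsol k (k * (k * A)) (- k * (- k * B)) x).
  apply: near_eq_is_derive (is_derive_expsol k _ _ x).
  by near=> t; apply/esym/y'E; near: t; exact: open_nbhs_nbhs.
split=> //; first exact: y'E.
by rewrite derive1nS derive1n1 derive1E y2 yE// /expsol; ring.
Unshelve. all: by end_near. Qed.

(** The dominating function [C^2 exp (- 2 k x)] is [C^2 / (2 k)] times the exponential density of
    rate [2 k], which is integrable. *)
Lemma Lfun2_exp_decay {R : realType} (f : R -> R) (k C : R) :
  0 < k -> measurable_fun setT f -> (forall x, 0 < x -> `|f x| <= C * expR (- (k * x))) ->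
  f \_ `]0, +oo[ \in Lfun (@lebesgue_measure R) 2%:E.
Proof.
move=> k0 mf fC.
have mg : measurable_fun setT (f \_ `]0, +oo[).
  by apply/measurable_restrict => //; apply: measurable_funTS.
rewrite inE; apply/andP; split; rewrite inE//= /finite_norm unlock.
apply: poweR_lty.
have /integrableP[] : (@lebesgue_measure R).-integrable setT
    (fun x => (C ^+ 2 / (2 * k))%:E * (exponential_pdf (2 * k) x)%:E)%E.
  by apply: integrableZl => //; apply: integrable_exponential_pdf; rewrite ?mulr_ge0 ?mulr_gt0// ltW.
move=> mpdf; apply: le_lt_trans; apply: ge0_le_integral => //.
- by move=> x _; exact: poweR_ge0.
- apply/measurable_EFinP.
  apply/(@measurableT_comp _ _ _ _ _ _ (fun x : R => x `^ 2)%R) => //.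
  exact/measurableT_comp.
- exact: measurableT_comp.
move=> x _; rewrite /= lee_fin powR_mulrn// -normrX patchE.
rewrite ger0_norm ?sqr_ge0//; apply: le_trans (ler_norm _).
case: ifPn => [|_]; last first.
  by rewrite expr0n mulr_ge0 ?divr_ge0 ?sqr_ge0 ?exponential_pdf_ge0 ?mulr_ge0 ?(ltW k0).
rewrite inE/= in_itv/= andbT => x0.
rewrite exponential_pdfE ?(ltW x0)// -(real_normK (num_real (f x))).
rewrite (le_trans (lerXn2r 2 _ _ (fC x x0))) ?nnegrE ?(le_trans _ (fC x x0))//.
rewrite exprMn -expRM_natl le_eqVlt; apply/orP; left; apply/eqP.
have -> : 2%:R * - (k * x) = - (2 * k) * x by ring.
by field; exact: lt0r_neq0.
Qed.

Lemma delta_negative_eigenvalue_exists {R : realType} (a beta : R) :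
  0 < a -> a^-1 < beta -> exists lam, delta_negative_eigenvalue a beta lam.
Proof.
move=> a0 ab; have [k k0 kbeta] := exists_decay_rate _ _ a0 ab.
exists (- k ^+ 2); split; first by rewrite oppr_lt0 exprn_gt0.
have ka0 : 0 < k * a by rewrite mulr_gt0.
pose E := expR (k * a); pose E' := expR (- (k * a)).
have E'0 : 0 < E' by exact: expR_gt0.
have EE' : E * E' = 1 by rewrite -expRD subrr expR0.
have E'E : E' < E by rewrite ltr_expR; lra.
pose s := (E - E')^-1.
have s0 : 0 < s by rewrite invr_gt0 subr_gt0.
have sE : s * (E - E') = 1 by rewrite mulVf// gt_eqF// subr_gt0.
(* [L x = sinh (k x) / sinh (k a)] and [D x = exp (- k (x - a))]. *)
pose L := expsol k s (- s); pose D := expsol k 0 E.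
have La : L a = 1 by rewrite /L /expsol -/E -/E' mulNr -mulrBr.
have Da : D a = 1 by rewrite /D /expsol mul0r add0r.
(* Equal to [L] before [a] and to [D] after it; this form is visibly continuous. *)
pose y x := L (Num.min x a) + D (Num.max x a) - 1.
have yL x : x <= a -> y x = L x.
  by move=> xa; rewrite /y (min_idPl xa) (max_idPr xa) Da addrK.
have yD x : a <= x -> y x = D x.
  by move=> xa; rewrite /y (min_idPr xa) (max_idPl xa) La addrC addrA addNr add0r.
have cy : continuous y.
  move=> x; apply: cvgB; last exact: cvg_cst.
  apply: cvgD.
    apply: (@continuous_comp _ _ _ (fun x => Num.min x a) L); last exact: continuous_expsol.
    by apply: (@continuous_min _ _ id (cst a)) => //; exact: cst_continuous.
  apply: (@continuous_comp _ _ _ (fun x => Num.max x a) D); last exact: continuous_expsol.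
  by apply: (@continuous_max _ _ id (cst a)) => //; exact: cst_continuous.
have odeL := ode_expsol [set x | x < a] y k s (- s) (@open_lt _ a) (fun x xa => yL x (ltW xa)).
have odeD := ode_expsol [set x | a < x] y k 0 E (@open_gt _ a) (fun x xa => yD x (ltW xa)).
exists y; split.
(* The bound [E exp (- k x)] is [D x]: it equals [y x] after [a], and before [a] it is at least 1
   while [0 <= y x <= 1]. *)
- apply: (Lfun2_exp_decay _ k E k0); first exact: continuous_measurable_fun.
  move=> x x0.
  have [xa|ax] := leP x a.
    have kxa : k * x <= k * a by rewrite ler_pM2l.
    have kx0 : 0 < k * x by rewrite mulr_gt0.
    have y0 : 0 <= y x.
      rewrite yL// /L /expsol mulNr -mulrBr mulr_ge0 ?(ltW s0)// subr_ge0 ler_expR.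
      lra.
    rewrite ger0_norm// (@le_trans _ _ 1)//.
      rewrite yL// /L /expsol mulNr -mulrBr -sE ler_wpM2l ?(ltW s0)//.
      by rewrite lerB// ler_expR// lerN2.
    by rewrite -expRD (le_trans _ (expR_ge1Dx _))//; lra.
  by rewrite yD ?(ltW ax)// /D /expsol mul0r add0r ger0_norm ?mulr_ge0 ?expR_ge0.
- exact: continuous_subspaceT.
- split; last by rewrite yL.
  by rewrite yL ?ltW// /L /expsol mulr0 oppr0 expR0 mulNr addrN.
- move=> x [/andP[_ xa]|ax].
    by have [? ? _ ->] := odeL x xa; split=> //; rewrite mulNr.
  by have [? ? _ ->] := odeD x ax; split=> //; rewrite mulNr.
- exists (expsol k (k * s) (- k * - s) a), (expsol k (k * 0) (- k * E) a); split.
  + apply: (@cvg_trans _ (expsol k (k * s) (- k * - s) x @[x --> a^'-])).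
      by apply: near_eq_cvg; near=> x; have [|_ _ ->] := odeL x; [near: x; exact: nbhs_left_lt|].
    exact/cvg_at_left_filter/continuous_expsol.
  + apply: (@cvg_trans _ (expsol k (k * 0) (- k * E) x @[x --> a^'+])).
      by apply: near_eq_cvg; near=> x; have [|_ _ ->] := odeD x; [near: x; exact: nbhs_right_gt|].
    exact/cvg_at_right_filter/continuous_expsol.
  + have E2 : expR (- (2 * (k * a))) = E' * E'.
      by rewrite -expRD; congr expR; ring.
    rewrite yL// La mulr1 /expsol -/E -/E'.
    (* The equation for [k] multiplied by [E]. It gives [beta = 2 k s E], which matches
       [dl - dr = k s (E + E') + k] once this last 1 is written [s (E - E')]. *)
    have b1 : beta * (E - E') = 2 * k * E.
      rewrite kbeta E2.
      transitivity (beta * (E - E' * (E * E'))); last by ring.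
      by rewrite EE' mulr1.
    have -> : beta = 2 * k * (s * E).
      transitivity (s * (beta * (E - E'))); first by rewrite mulrCA sE mulr1.
      by rewrite b1; ring.
    transitivity (k * (E * E') + k * (s * E + s * E')); first by ring.
    by rewrite EE' -[in X in X + _]sE; ring.
Unshelve. all: by end_near. Qed.

(** * The critical coupling and its limit *)

(** If [b < a^-1], their midpoint lies above [b], so it has a negative eigenvalue, yet it lies below
    [a^-1]. *)
Lemma is_critical_coupling_ge {R : realType} (a b : R) :
  0 < a -> is_critical_coupling a b -> a^-1 <= b.
Proof.
move=> a0 [b0 _ eig]; rewrite leNgt; apply/negP => ba.
have [lam] := eig _ (midf_lt ba).1.
by move=> /(delta_negative_eigenvalue_ge _ _ _ a0); rewrite leNgt (midf_lt ba).2.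
Qed.

(** Existence of a critical value ensures that [get] in [beta_cr] returns one instead of its
    default. *)
Lemma is_critical_coupling_inv {R : realType} (a : R) :
  0 < a -> is_critical_coupling a a^-1.
Proof.
move=> a0; split=> [|beta _ ba [lam]|beta]; first by rewrite invr_ge0 ltW.
  by move=> /(delta_negative_eigenvalue_ge _ _ _ a0); rewrite leNgt ba.
exact: delta_negative_eigenvalue_exists.
Qed.

Theorem theorem2p2 (R : realType) (a : nat -> R)
    (a_gt0 : forall n, 0 < a n) (a_cvg0 : a n @[n --> \oo] --> 0) :
  beta_cr (a n) @[n --> \oo] --> +oo.
Proof.
have beta_ge n : (a n)^-1 <= beta_cr (a n).
  apply: is_critical_coupling_ge => //.
  by apply: (@getPex R); exists (a n)^-1; exact: is_critical_coupling_inv.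
apply/cvgryPge => M; near=> n; apply: le_trans (beta_ge n).
(* Positivity makes [(|M| + 1)^-1] an admissible eventual bound for [a n]; inverting gives
   [|M| + 1 <= (a n)^-1]. *)
have M0 : 0 < `|M| + 1 by rewrite ltr_wpDl.
rewrite (le_trans (ler_norm M))// (@le_trans _ _ (`|M| + 1)) ?lerDl//.
rewrite -[leLHS]invrK lef_pV2 ?posrE ?invr_gt0//.
rewrite (le_trans (ler_norm _))//; near: n.
by apply: (@cvgr0_norm_le _ R^o _ _ _ _ a_cvg0); rewrite invr_gt0.
Unshelve. all: by end_near. Qed.
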